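(* There is an absolute constant $C>0$ such that the following holds. Fix a policy $\pi$ (not depending on the samples) whose gain $\rho^\pi$ is a constant vector, and let $\widehat\rho^\pi$ be its gain in the empirical MDP $(\widehat P,r)$. Then for every $\delta\in(0,1)$, with probability at least $1-\delta$, $$\|\widehat\rho^\pi-\rho^\pi\|_\infty\le\sqrt{\frac{C\log^3\!\big(\frac{SAn}{\delta}\big)}{n}\big(\|h^\pi\|_{\mathrm{sp}}+1\big)} .$$
   Context: $\mathcal S$ is a finite state set with $S$ elements, $\mathcal A$ a finite action set with $A$ elements; $P$ is a transition kernel and $r:\mathcal S\times\mathcal A\to[0,1]$ a known deterministic reward. Policies are stationary Markov, possibly randomized; $P_\pi(s,s')=\sum_a\pi(a|s)P(s'|s,a)$, $r_\pi(s)=\sum_a\pi(a|s)r(s,a)$. Empirical kernel: for each $(s,a)$, $n$ i.i.d. samples $S^i_{s,a}\sim P(\cdot|s,a)$, independent across pairs, and $\widehat P(s'|s,a)=\frac1n\sum_{i=1}^n\mathbb 1\{S^i_{s,a}=s'\}$. $P^\infty_\pi$ is the Cesàro limit of $P^t_\pi$; gain $\rho^\pi=P^\infty_\pi r_\pi$; bias $h^\pi=\mathrm{C\text{-}lim}_{T\to\infty}\sum_{t=0}^{T-1}(P^t_\pi r_\pi-\rho^\pi)$. $\widehat\rho^\pi$ is defined the same way with $\widehat P$. $\|x\|_{\mathrm{sp}}=\max_s x(s)-\min_s x(s)$. *)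

(* Defs.v *)
From HB Require Import structures.
From mathcomp Require Import all_boot all_order all_algebra.
From mathcomp Require Import all_classical all_reals all_analysis.
Set Implicit Arguments. Unset Strict Implicit. Unset Printing Implicit Defensive.
Import Order.TTheory GRing.Theory Num.Theory numFieldNormedType.Exports.
Local Open Scope ring_scope.

Section MDP.
Variables (R : realType) (S A : finType).

Definition is_kernel (P : S -> A -> S -> R) : Prop :=
  (forall s a s', 0 <= P s a s') /\ (forall s a, \sum_(s' : S) P s a s' = 1).

Definition is_policy (pi : S -> A -> R) : Prop :=
  (forall s a, 0 <= pi s a) /\ (forall s, \sum_(a : A) pi s a = 1).

Definition Ppi (P : S -> A -> S -> R) (pi : S -> A -> R) (s s' : S) : R :=
  \sum_(a : A) pi s a * P s a s'.

Definition rpi (r : S -> A -> R) (pi : S -> A -> R) (s : S) : R :=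
  \sum_(a : A) pi s a * r s a.

Definition Ppow (P : S -> A -> S -> R) (pi : S -> A -> R) (t : nat)
  (v : S -> R) : S -> R :=
  iter t (fun w s => \sum_(s' : S) Ppi P pi s s' * w s') v.

Definition clim (a : nat -> R) : R :=
  limn (fun N : nat => (\sum_(T < N.+1) a T) / N.+1%:R).

Definition gain (P : S -> A -> S -> R) (pi : S -> A -> R) (r : S -> A -> R)
  (s : S) : R :=
  clim (fun t => Ppow P pi t (rpi r pi) s).

Definition bias (P : S -> A -> S -> R) (pi : S -> A -> R) (r : S -> A -> R)
  (s : S) : R :=
  clim (fun T => \sum_(t < T) (Ppow P pi t (rpi r pi) s - gain P pi r s)).

(* span seminorm: max_s x(s) - min_s x(s) (= 0 on an empty state space) *)
Definition spnorm (x : S -> R) : R :=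
  \big[Num.max/0]_(s : S) \big[Num.max/0]_(s' : S) (x s - x s').

Definition supnorm (x : S -> R) : R := \big[Num.max/0]_(s : S) `|x s|.

(* Sample outcome: omega (s,a,i) = S^i_{s,a}, i < n *)
Definition sample_space (n : nat) := {ffun (S * A * 'I_n)%type -> S}.

Definition Phat (n : nat) (w : sample_space n) (s : S) (a : A) (s' : S) : R :=
  (\sum_(i < n) (w (s, a, i) == s')%:R) / n%:R.

Definition prob (P : S -> A -> S -> R) (n : nat) (E : pred (sample_space n)) : R :=
  \sum_(w : sample_space n | E w) \prod_(k : (S * A * 'I_n)%type) P k.1.1 k.1.2 (w k).

End MDP.

(* Main.v *)
Require Import Defs.
From HB Require Import structures.
From mathcomp Require Import all_boot all_order all_algebra.
From mathcomp Require Import all_classical all_reals all_analysis.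
From mathcomp Require Import ring lra zify.
Set Implicit Arguments. Unset Strict Implicit. Unset Printing Implicit Defensive.
Import Order.TTheory GRing.Theory Num.Theory numFieldNormedType.Exports.
Local Open Scope ring_scope.

(** The Poisson equation [rho + h = r_pi + P_pi h] with constant [rho], integrated against the law [mu] to which the empirical chain converges in Cesaro mean, gives [rhohat - rho = mu ((Phat_pi - P_pi) h)], where [h] does not depend on the samples. Bernstein's inequality, in its linear form [lam * dev <= lam^2 * Var + L / n] for a fixed [lam], reduces the claim to bounding [X], the [mu]-average of the variance of [h] under [P]. Squaring the Poisson equation bounds [X] by [2 B - mu ((Phat_pi - P_pi) h^2)] with [B = sp h + 1], and Bernstein's inequality for [h^2], whose variance is at most [4 B^2] times that of [h], turns this into [X = O(B)] as soon as [L B <= n]. When [L B > n] the claim is trivial, gains being in [0, 1]. *)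

(** * Cesaro limits and the Poisson equation for a finite stochastic matrix *)

Section StochasticMatrix.
Variables (R : realType) (S : finType) (Q : S -> S -> R).
Hypotheses (Q_ge0 : forall s s', 0 <= Q s s') (Q_sum1 : forall s, \sum_s' Q s s' = 1).

(** For [Q := Ppi P pi] this is, up to conversion, the map iterated in [Ppow], and [cesaro_mean] is
    the sequence under the limit in [clim]; so [gain] and [bias] are instances of the limits
    below. *)
Definition markov_op (f : S -> R) (s : S) : R := \sum_s' Q s s' * f s'.

Definition cesaro_mean (a : nat -> R) (N : nat) : R := (\sum_(T < N.+1) a T) / N.+1%:R.

Lemma markov_opE f s : markov_op f s = \sum_s' Q s s' * f s'.
Proof. by []. Qed.

Lemma markov_opB f g s :
  markov_op (fun x => f x - g x) s = markov_op f s - markov_op g s.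
Proof. by rewrite /markov_op -sumrB; apply: eq_bigr => s' _; rewrite mulrBr. Qed.

Lemma markov_opD f g s :
  markov_op (fun x => f x + g x) s = markov_op f s + markov_op g s.
Proof. by rewrite /markov_op -big_split; apply: eq_bigr => s' _; rewrite mulrDr. Qed.

Lemma markov_iterB t f g s :
  iter t markov_op (fun x => f x - g x) s = iter t markov_op f s - iter t markov_op g s.
Proof.
elim: t s => //= t IH s; rewrite -markov_opB.
by congr (markov_op _ s); apply/funext => x; rewrite IH.
Qed.

Lemma markov_iterD t f g s :
  iter t markov_op (fun x => f x + g x) s = iter t markov_op f s + iter t markov_op g s.
Proof.
elim: t s => //= t IH s; rewrite -markov_opD.
by congr (markov_op _ s); apply/funext => x; rewrite IH.
Qed.

Lemma markov_iter_ge0 t f : (forall s, 0 <= f s) -> forall s, 0 <= iter t markov_op f s.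
Proof.
move=> f0; elim: t => //= t IH s; apply: sumr_ge0 => s' _.
exact: mulr_ge0.
Qed.

Lemma markov_iter_norm_le t f K : (forall s, `|f s| <= K) ->
  forall s, `|iter t markov_op f s| <= K.
Proof.
move=> fK; elim: t => //= t IH s; apply: (le_trans (ler_norm_sum _ _ _)).
rewrite -[leRHS]mul1r -(Q_sum1 s) mulr_suml; apply: ler_sum => s' _.
by rewrite normrM ger0_norm// ler_wpM2l.
Qed.

(** Linearity reduces the Cesaro limits of all functions to those of indicators, which become the
    weights of [mu]. *)
Lemma markov_iter_sum_delta t f s :
  iter t markov_op f s =
  \sum_x f x * iter t markov_op (fun y => (y == x)%:R) s.
Proof.
elim: t s => [|t IH] s /=.
  rewrite (bigD1 s)//= eqxx mulr1 big1 ?addr0// => x /negbTE xs.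
  by rewrite eq_sym xs mulr0.
rewrite markov_opE; rewrite (eq_bigr _ (fun s' _ => congr1 _ (IH s'))).
under eq_bigr do rewrite mulr_sumr.
rewrite exchange_big; apply: eq_bigr => x _; rewrite markov_opE mulr_sumr.
by apply: eq_bigr => y _; rewrite mulrCA.
Qed.

Lemma bounded_div_cvg0 (b : nat -> R) K : (forall N, `|b N| <= K) ->
  ((fun N => b N / N.+1%:R) @ \oo --> (0 : R))%classic.
Proof.
move=> bK.
have h0 : ((fun N => K * harmonic N) @ \oo --> (0 : R))%classic.
  by rewrite -[X in (_ --> X)%classic](mulr0 K); apply: cvgM; [exact: cvg_cst|exact: cvg_harmonic].
apply: (@squeeze_cvgr _ _ _ _ (fun N => - (K * harmonic N)) (fun N => K * harmonic N)).
- apply: nearW => N; rewrite -ler_norml normrM [X in _ * X]ger0_norm ?invr_ge0 ?ler0n//.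
  by rewrite /harmonic ler_wpM2r ?invr_ge0 ?ler0n.
- by rewrite -oppr0; apply: cvgN; exact: h0.
- exact: h0.
Qed.

(** Iterating gives [Q^t y = y - t x]. The left side stays bounded in [t], so [x] must vanish. *)
Lemma harmonic_coboundary_eq0 x y :
  (forall s, markov_op x s = x s) -> (forall s, x s = y s - markov_op y s) ->
  forall s, x s = 0.
Proof.
move=> Qx xy s.
have itE t s1 : iter t markov_op y s1 = y s1 - t%:R * x s1.
  elim: t s1 => [|t IH] s1 /=; first by rewrite mul0r subr0.
  rewrite (_ : iter t markov_op y = fun z => y z - t%:R * x z); last exact/funext.
  rewrite markov_opB.
  have -> : markov_op (fun z => t%:R * x z) s1 = t%:R * x s1.
    rewrite -[in RHS]Qx /markov_op mulr_sumr.
    by apply: eq_bigr => z _; rewrite mulrCA.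
  by rewrite -natr1 mulrDl mul1r; have := xy s1; lra.
pose K := \sum_z `|y z|.
have yK z : `|y z| <= K.
  by rewrite /K (bigD1 z)//= lerDl; apply: sumr_ge0.
apply/eqP; apply: contraT => xn0.
have xp : 0 < `|x s| by rewrite normr_gt0.
pose t := (Num.bound ((K + K) / `|x s|)).
have K0 : 0 <= (K + K) / `|x s|.
  by apply: divr_ge0 => //; rewrite addr_ge0// (le_trans _ (yK s)).
have := archi_boundP K0; rewrite -/t ltr_pdivrMr//.
have : `|t%:R * x s| <= K + K.
  have -> : t%:R * x s = y s - iter t markov_op y s by rewrite itE; lra.
  apply: (le_trans (ler_normB _ _)); apply: lerD => //.
  exact: markov_iter_norm_le.
rewrite normrM normr_nat; lra.
Qed.

(* [I - Q] and its square have the same kernel, hence the same rank, so [(I - Q) v = (I - Q)^2 g] is solvable. *)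
Lemma harmonic_decomposition v : exists u g : S -> R,
  (forall s, markov_op u s = u s) /\ (forall s, v s = u s + (g s - markov_op g s)).
Proof.
(* The transpose of [I - Q], because row vectors are multiplied from the left. *)
pose M : 'M[R]_#|S| :=
  \matrix_(i, j) ((i == j)%:R - Q (enum_val j) (enum_val i)).
pose fn (x : 'rV[R]_#|S|) (s : S) := x 0 (enum_rank s).
have fnM x s : fn (x *m M) s = fn x s - markov_op (fn x) s.
  rewrite /fn mxE; under eq_bigr do rewrite mxE mulrBr.
  rewrite sumrB; congr (_ - _).
    rewrite (bigD1 (enum_rank s))//= eqxx mulr1 big1 ?addr0// => i /negbTE ->.
    by rewrite mulr0.
  rewrite /markov_op (reindex (@enum_rank S)); last first.
    by exists enum_val => z _; rewrite ?enum_rankK ?enum_valK.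
  by apply: eq_bigr => z _; rewrite !enum_rankK mulrC.
(* A vector in both the image and the kernel is a harmonic coboundary, hence zero. *)
have cap0 : (M :&: kermx M)%MS = 0.
  apply/eqP/rowV0P => x; rewrite sub_capmx => /andP[/submxP[y ->]] /sub_kermxP yMM.
  have y0 : forall s, fn (y *m M) s = 0.
    apply: (@harmonic_coboundary_eq0 _ (fn y)) => s; last exact: fnM.
    have := fnM (y *m M) s; rewrite yMM {1}/fn mxE; lra.
  apply/rowP => i; rewrite [RHS]mxE.
  by have := y0 (enum_val i); rewrite /fn enum_valK.
have MM : (M <= M *m M)%MS.
  have /mxrank_leqif_sup := submxMl M M; move/geq_leqif => <-.
  by rewrite -[leqLHS](mxrank_mul_ker M M) cap0 mxrank0 addn0.
pose vr : 'rV[R]_#|S| := \row_i v (enum_val i).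
have /submxP[y vE] := submx_trans (submxMl vr M) MM.
(* From [(I - Q) v = (I - Q)^2 y], the remainder [u = v - (I - Q) y] is harmonic. *)
exists (fn (vr - y *m M)), (fn y); split => s.
  have := fnM (vr - y *m M) s.
  rewrite mulmxBl -mulmxA -vE subrr {1}/fn mxE; lra.
rewrite -fnM /fn !mxE enum_rankK; lra.
Qed.

Lemma iter_harmonic t u : (forall s, markov_op u s = u s) ->
  forall s, iter t markov_op u s = u s.
Proof.
move=> Qu s; elim: t => //= t IH.
by rewrite -[in RHS]Qu -iterS iterSr (_ : markov_op u = u)//; apply/funext.
Qed.

Lemma sum_iter_coboundary T g s :
  \sum_(t < T) iter t markov_op (fun x => g x - markov_op g x) s =
  g s - iter T markov_op g s.
Proof.
elim: T => [|T IH]; first by rewrite big_ord0 subrr.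
rewrite big_ord_recr /= IH markov_iterB -iterSr /=; lra.
Qed.

(** The harmonic part is fixed by the iteration, while the coboundary part telescopes to a bounded
    term divided by [N + 1]. *)
Lemma cesaro_mean_harmonic_cvg v u g s :
  (forall s, markov_op u s = u s) -> (forall s, v s = u s + (g s - markov_op g s)) ->
  (cesaro_mean (fun t => iter t markov_op v s) @ \oo --> u s)%classic.
Proof.
move=> Qu vE.
have -> : cesaro_mean (fun t => iter t markov_op v s) =
   (fun N => u s + (g s - iter N.+1 markov_op g s) / N.+1%:R).
  apply/funext => N; rewrite /cesaro_mean.
  have -> : v = (fun x => u x + (g x - markov_op g x)) by apply/funext.
  under eq_bigr do rewrite markov_iterD (iter_harmonic _ Qu).
  rewrite big_split /= sum_iter_coboundary sumr_const card_ord mulrDl.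
  by rewrite -[u s *+ _]mulr_natr mulfK// pnatr_eq0.
rewrite -[X in (_ --> X)%classic]addr0.
apply: cvgD; first exact: cvg_cst.
pose K := \sum_z `|g z|.
have gK z : `|g z| <= K by rewrite /K (bigD1 z)//= lerDl; apply: sumr_ge0.
apply: (@bounded_div_cvg0 _ (K + K)) => N.
apply: (le_trans (ler_normB _ _)); apply: lerD => //.
exact: markov_iter_norm_le.
Qed.

(** [mu] is row [s] of the Cesaro limit of [Q^t]. *)
Lemma cesaro_stationary_law s : exists mu : S -> R,
  [/\ forall x, 0 <= mu x, \sum_x mu x = 1,
      forall f, \sum_x mu x * markov_op f x = \sum_x mu x * f x
    & forall f, (cesaro_mean (fun t => iter t markov_op f s) @ \oo --> \sum_x mu x * f x)%classic].
Proof.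
have lims f : exists l : R, (cesaro_mean (fun t => iter t markov_op f s) @ \oo --> l)%classic.
  have [u [g [Qu fE]]] := harmonic_decomposition f.
  by exists (u s); exact: cesaro_mean_harmonic_cvg Qu fE.
pose d x := fun y : S => (y == x)%:R : R.
have [mu muP] := choice (fun x => lims (d x)).
have mu_cvg f : (cesaro_mean (fun t => iter t markov_op f s) @ \oo --> \sum_x mu x * f x)%classic.
  have -> : cesaro_mean (fun t => iter t markov_op f s) =
     (fun N => \sum_x cesaro_mean (fun t => iter t markov_op (d x) s) N * f x).
    apply/funext => N; rewrite /cesaro_mean.
    under eq_bigr do rewrite markov_iter_sum_delta.
    rewrite exchange_big mulr_suml; apply: eq_bigr => x _.
    by rewrite -mulr_sumr -mulrA mulrC.
  apply: cvg_big => [|x _]; first exact: add_continuous.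
   apply: cvgM; [exact: muP|exact: cvg_cst].
have uni f l : (cesaro_mean (fun t => iter t markov_op f s) @ \oo --> l)%classic ->
    l = \sum_x mu x * f x.
  by move=> fl; exact: cvg_unique fl (mu_cvg f).
exists mu; split => //.
- move=> x; apply: (cvgr_to_ge (muP x)); apply: nearW => N.
  rewrite /cesaro_mean divr_ge0// sumr_ge0// => t _.
  by apply: markov_iter_ge0 => y; rewrite /d.
- transitivity (\sum_x mu x * (fun=> 1) x).
    by apply: eq_bigr => x _; rewrite mulr1.
  symmetry; apply: uni.
  apply: (@cesaro_mean_harmonic_cvg _ (fun=> 1) (fun=> 0)) => z.
    by rewrite /markov_op; under eq_bigr do rewrite mulr1.
  by rewrite /markov_op big1 ?subrr ?addr0// => y _; rewrite mulr0.
(* [f] and [Q f] share the harmonic part [u], with coboundaries generated by [g] and [Q g]; hence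
   they have the same limit. *)
- move=> f; have [u [g [Qu fE]]] := harmonic_decomposition f.
  rewrite -(uni f (u s)); last exact: cesaro_mean_harmonic_cvg Qu fE.
  rewrite -(uni (markov_op f) (u s))//.
  apply: (@cesaro_mean_harmonic_cvg _ u (markov_op g)) => // z.
  rewrite -markov_opB -[in RHS]Qu -markov_opD.
  by congr (markov_op _ z); apply/funext => y; rewrite fE.
Qed.

(** Decompose [f = u + (g - Q g)], then [g] itself with harmonic part [u']. The centred partial sums
    telescope to [g - Q^T g], so that [rho = u] and [h = g - u'], and the equation is the first
    decomposition. *)
Lemma poisson_of_cesaro (f rho h : S -> R) :
  (forall s, rho s = limn (cesaro_mean (fun t => iter t markov_op f s))) ->
  (forall s, h s = limn (cesaro_mean
     (fun T => \sum_(t < T) (iter t markov_op f s - rho s)))) ->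
  forall s, rho s + h s = f s + markov_op h s.
Proof.
move=> rhoE hE.
have [u [g [Qu fE]]] := harmonic_decomposition f.
have [u' [g' [Qu' gE]]] := harmonic_decomposition g.
have ru s : rho s = u s.
  by rewrite rhoE; apply: cvg_lim => //; exact: cesaro_mean_harmonic_cvg Qu fE.
have hg s : h s = g s - u' s.
  rewrite hE; apply: cvg_lim => //.
  have -> : cesaro_mean (fun T => \sum_(t < T) (iter t markov_op f s - rho s)) =
     (fun N => g s - cesaro_mean (fun T => iter T markov_op g s) N).
    apply/funext => N; rewrite /cesaro_mean.
    have sumE T : \sum_(t < T) (iter t markov_op f s - rho s) = g s - iter T markov_op g s.
      rewrite -sum_iter_coboundary; apply: eq_bigr => t _.
      rewrite ru (_ : f = fun x => u x + (g x - markov_op g x)); last exact/funext.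
      by rewrite markov_iterD (iter_harmonic _ Qu) addrAC subrr add0r.
    under eq_bigr do rewrite sumE.
    rewrite sumrB sumr_const card_ord mulrBl.
    by rewrite -[g s *+ _]mulr_natr mulfK// pnatr_eq0.
  apply: cvgB; first exact: cvg_cst.
  exact: cesaro_mean_harmonic_cvg Qu' gE.
move=> s.
have -> : h = fun x => g x - u' x by exact/funext.
rewrite markov_opB Qu' ru fE; lra.
Qed.

End StochasticMatrix.

(** * Gain and bias of a policy *)

Section Gain.
Variables (R : realType) (S A : finType) (P : S -> A -> S -> R).
Variables (pi : S -> A -> R) (r : S -> A -> R).
Hypotheses (kP : is_kernel P) (kpi : is_policy pi) (r01 : forall s a, 0 <= r s a <= 1).

Lemma markov_op_PpiE f s :
  markov_op (Ppi P pi) f s = \sum_a pi s a * \sum_s' P s a s' * f s'.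
Proof.
rewrite markov_opE; under eq_bigr do rewrite mulr_suml.
rewrite exchange_big; apply: eq_bigr => a _; rewrite mulr_sumr.
by apply: eq_bigr => s' _; rewrite mulrA.
Qed.

Lemma Ppi_ge0 s s' : 0 <= Ppi P pi s s'.
Proof. by apply: sumr_ge0 => a _; rewrite mulr_ge0// (kP.1, kpi.1). Qed.

Lemma Ppi_sum1 s : \sum_s' Ppi P pi s s' = 1.
Proof.
rewrite /Ppi exchange_big -[RHS](kpi.2 s); apply: eq_bigr => a _.
by rewrite -mulr_sumr kP.2 mulr1.
Qed.

Lemma gain_law s : exists mu : S -> R,
  [/\ forall x, 0 <= mu x, \sum_x mu x = 1,
      forall f, \sum_x mu x * markov_op (Ppi P pi) f x = \sum_x mu x * f x
    & gain P pi r s = \sum_x mu x * rpi r pi x].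
Proof.
have [mu [mu0 mu1 mus mul]] := cesaro_stationary_law Ppi_ge0 Ppi_sum1 s.
by exists mu; split => //; apply: cvg_lim => //; exact: mul.
Qed.

Lemma rpi_ge0_le1 s : 0 <= rpi r pi s <= 1.
Proof.
apply/andP; split.
  by apply: sumr_ge0 => a _; rewrite mulr_ge0// ?kpi.1//; case/andP: (r01 s a).
rewrite -(kpi.2 s); apply: ler_sum => a _.
by rewrite -[leRHS]mulr1 ler_wpM2l ?kpi.1//; case/andP: (r01 s a).
Qed.

Lemma gain_ge0_le1 s : 0 <= gain P pi r s <= 1.
Proof.
have [mu [mu0 mu1 _ ->]] := gain_law s.
apply/andP; split.
  by apply: sumr_ge0 => x _; rewrite mulr_ge0//; case/andP: (rpi_ge0_le1 x).
rewrite -mu1; apply: ler_sum => x _.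
by rewrite -[leRHS]mulr1 ler_wpM2l//; case/andP: (rpi_ge0_le1 x).
Qed.

Lemma poisson_equation s :
  gain P pi r s + bias P pi r s = rpi r pi s + markov_op (Ppi P pi) (bias P pi r) s.
Proof.
exact: (@poisson_of_cesaro _ _ _ Ppi_ge0 Ppi_sum1 (rpi r pi)).
Qed.

End Gain.

(** * The product law of the samples and Bernstein's inequality *)

Section Sampling.
Variables (R : realType) (S A : finType) (P : S -> A -> S -> R) (n : nat).
Hypothesis kP : is_kernel P.

Local Notation sprob w := (\prod_(k : S * A * 'I_n) P k.1.1 k.1.2 ((w : sample_space S A n) k)).

Lemma sprob_ge0 (w : sample_space S A n) : 0 <= sprob w.
Proof. by apply: prodr_ge0 => k _; apply: kP.1. Qed.

Lemma sum_sprob : \sum_(w : sample_space S A n) sprob w = 1.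
Proof.
rewrite -(bigA_distr_bigA (fun k => P k.1.1 k.1.2)) big1// => k _.
exact: kP.2.
Qed.

Lemma probE (E : pred (sample_space S A n)) : prob P E = \sum_w sprob w * (E w)%:R.
Proof.
rewrite /prob big_mkcond; apply: eq_bigr => w _.
by case: (E w); rewrite ?mulr1 ?mulr0.
Qed.

Lemma prob_le (E F : pred (sample_space S A n)) :
  (forall w, E w -> F w) -> prob P E <= prob P F.
Proof.
move=> EF; rewrite !probE; apply: ler_sum => w _.
by rewrite ler_wpM2l ?sprob_ge0// ler_nat; have := EF w; case: (E w) => // ->.
Qed.

Lemma probT (E : pred (sample_space S A n)) : (forall w, E w) -> prob P E = 1.
Proof.
by move=> ET; rewrite probE -[RHS]sum_sprob; apply: eq_bigr => w _; rewrite ET mulr1.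
Qed.

(** Union bound, proved outcome by outcome: either all [B i] hold or some failure indicator equals
    1. *)
Lemma prob_forall_ge (I : finType) (B : I -> pred (sample_space S A n)) :
  1 - \sum_i prob P (predC (B i)) <= prob P [pred w | [forall i, B i w]].
Proof.
rewrite lerBlDr -[leLHS]sum_sprob !probE; under [X in _ <= _ + X]eq_bigr do rewrite probE.
rewrite exchange_big -big_split /=; apply: ler_sum => w _.
rewrite -mulr_sumr -mulrDr -[leLHS]mulr1 ler_wpM2l ?sprob_ge0//.
have s0 : 0 <= \sum_i (~~ B i w)%:R :> R by apply: sumr_ge0.
have [aB|] := boolP [forall i, B i w]; first by rewrite lerDl.
rewrite negb_forall => /existsP[i Bi]; rewrite add0r (bigD1 i)//= Bi.
by rewrite lerDl; apply: sumr_ge0.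
Qed.

Lemma prob_markov (E : pred (sample_space S A n)) (Z : sample_space S A n -> R) :
  (forall w, 0 <= Z w) -> (forall w, E w -> 1 <= Z w) ->
  prob P E <= \sum_w sprob w * Z w.
Proof.
move=> Z0 EZ; rewrite probE; apply: ler_sum => w _.
by rewrite ler_wpM2l ?sprob_ge0//; have := EZ w; case: (E w) => // /(_ isT).
Qed.

Lemma prod_row (p : S * A) (F : S * A * 'I_n -> R) :
  \prod_k (if k.1 == p then F k else 1) = \prod_(i < n) F (p, i).
Proof.
transitivity (\prod_q \prod_(i < n) (if q == p then F (q, i) else 1)).
  by rewrite pair_bigA; apply: eq_bigr => -[].
rewrite (bigD1 p)//= eqxx [X in _ * X]big1 ?mulr1// => q /negbTE ->.
by rewrite big1.
Qed.

(* From [exp (- x / 2) >= 1 - x / 2], squared. *)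
Lemma expR_le_quadratic (x : R) : x <= 1 / 3 -> expR x <= 1 + x + x ^+ 2.
Proof.
move=> x3.
have e1 : 1 - x / 2 <= expR (- (x / 2)) by have := expR_ge1Dx (- (x / 2)).
have p0 : 0 <= 1 - x / 2 by lra.
have : (1 - x / 2) ^+ 2 <= expR (- (x / 2)) ^+ 2 by rewrite ler_pXn2r// nnegrE ltW// expR_gt0.
rewrite -expRM_natl (_ : 2%:R * - (x / 2) = - x); last by field.
rewrite expRN => e2.
have q0 : 0 <= 1 + x + x ^+ 2 by nra.
(* The excess over 1 is [x^2 (1 - 3 x + x^2) / 4], nonnegative since [x <= 1 / 3]. *)
have e3 : (1 + x + x ^+ 2) * (1 - x / 2) ^+ 2 >= 1.
  have -> : (1 + x + x ^+ 2) * (1 - x / 2) ^+ 2 = 1 + x ^+ 2 * (1 - 3 * x + x ^+ 2) / 4 by field.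
  rewrite lerDl divr_ge0// mulr_ge0 ?sqr_ge0//; have := sqr_ge0 x; lra.
have := ler_wpM2l q0 e2 => e4.
by have := le_trans e3 e4; rewrite -ler_pdivrMr ?invr_gt0 ?expR_gt0// div1r invrK.
Qed.

Lemma mgf_le p (g : S -> R) : (forall x, g x <= 1 / 3) ->
  \sum_x P p.1 p.2 x * g x = 0 ->
  \sum_x P p.1 p.2 x * expR (g x) <= expR (\sum_x P p.1 p.2 x * g x ^+ 2).
Proof.
move=> g3 g0; apply: (le_trans _ (expR_ge1Dx _)).
apply: (@le_trans _ _ (\sum_x P p.1 p.2 x * (1 + g x + g x ^+ 2))).
  by apply: ler_sum => x _; rewrite ler_wpM2l ?kP.1// expR_le_quadratic.
under eq_bigr do rewrite !mulrDr mulr1.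
by rewrite !big_split /= kP.2 g0 addr0.
Qed.

(** Chernoff's method with exponent 1, the scale being absorbed in [g]. By independence the
    exponential moment factors over the samples, and the [n] factors [expR v] cancel the term
    [n v]. *)
Lemma bernstein_tail p (g : S -> R) (L : R) : (forall x, g x <= 1 / 3) ->
  \sum_x P p.1 p.2 x * g x = 0 ->
  prob P (predC [pred w : sample_space S A n |
     \sum_(i < n) g (w (p, i)) <= n%:R * (\sum_x P p.1 p.2 x * g x ^+ 2) + L])
  <= expR (- L).
Proof.
move=> g3 g0; set v := \sum_x _.
pose Z (w : sample_space S A n) := expR (\sum_(i < n) g (w (p, i)) - (n%:R * v + L)).
apply: (@le_trans _ _ (\sum_w sprob w * Z w)).
  apply: prob_markov => w; first exact: expR_ge0.
  rewrite /= -ltNge => ltw; rewrite -expR0 ler_expR; lra.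
(* The factor at coordinate [k]; only the samples of the pair [p] carry the exponential. *)
pose F (k : S * A * 'I_n) (x : S) :=
  P k.1.1 k.1.2 x * (if k.1 == p then expR (g x) else 1).
have ZE w : sprob w * Z w = expR (- (n%:R * v + L)) * \prod_k F k (w k).
  rewrite /Z expRD expR_sum big_split /= (prod_row p (fun k => expR (g (w k)))).
  by rewrite mulrA mulrC.
under eq_bigr do rewrite ZE.
rewrite -mulr_sumr -(bigA_distr_bigA F).
have -> : - L = - (n%:R * v + L) + n%:R * v by lra.
rewrite expRD ler_wpM2l ?expR_ge0// expRM_natl.
have -> : expR v ^+ n = \prod_(k : S * A * 'I_n) (if k.1 == p then expR v else 1).
  by rewrite (prod_row p (fun=> expR v)) prodr_const card_ord.
apply: ler_prod => k _; rewrite /F; apply/andP; split.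
  apply: sumr_ge0 => x _; rewrite mulr_ge0 ?kP.1//.
  by case: ifP => // _; exact: expR_ge0.
case: ifP => [/eqP ->|_]; first exact: mgf_le.
by under eq_bigr do rewrite mulr1; rewrite kP.2.
Qed.

(** The index is separate from the pair [sa i], so that one pair can carry several test
    functions. *)
Lemma bernstein_uniform (I : finType) (sa : I -> S * A) (g : I -> S -> R) (L : R) :
  (forall i x, g i x <= 1 / 3) ->
  (forall i, \sum_x P (sa i).1 (sa i).2 x * g i x = 0) ->
  1 - #|I|%:R * expR (- L) <=
  prob P [pred w : sample_space S A n | [forall i, \sum_(j < n) g i (w (sa i, j)) <=
     n%:R * (\sum_x P (sa i).1 (sa i).2 x * g i x ^+ 2) + L]].
Proof.
move=> g3 g0; apply: le_trans (prob_forall_ge _).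
rewrite lerB// mulr_natl -sumr_const; apply: ler_sum => i _.
exact: bernstein_tail.
Qed.

Lemma Phat_sum (w : sample_space S A n) s a f :
  \sum_s' @Phat R S A n w s a s' * f s' = (\sum_(i < n) f (w (s, a, i))) / n%:R.
Proof.
under eq_bigr do rewrite /Phat mulrAC mulr_suml.
rewrite -mulr_suml exchange_big; congr (_ / _); apply: eq_bigr => i _.
rewrite (bigD1 (w (s, a, i)))//= eqxx mul1r big1 ?addr0// => x /negbTE xw.
by rewrite eq_sym xw mul0r.
Qed.

Lemma Phat_kernel (w : sample_space S A n) : (0 < n)%N -> is_kernel (@Phat R S A n w).
Proof.
move=> n0; split => s a => [s'|]; first by rewrite divr_ge0// sumr_ge0.
under eq_bigr do rewrite -[Phat _ _ _ _]mulr1.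
rewrite (Phat_sum w s a (fun=> 1)) sumr_const card_ord divff// pnatr_eq0.
by rewrite -lt0n.
Qed.

End Sampling.

(** * Deterministic bound on the gain deviation *)

Section GainDeviation.
Variables (R : realType) (S A : finType).
Implicit Types (P : S -> A -> S -> R) (f : S -> R).

Definition kernel_mean P s a f : R := \sum_s' P s a s' * f s'.

Definition kernel_var P s a f : R :=
  \sum_s' P s a s' * (f s' - kernel_mean P s a f) ^+ 2.

Lemma kernel_meanB P s a f g :
  kernel_mean P s a (fun x => f x - g x) = kernel_mean P s a f - kernel_mean P s a g.
Proof. by rewrite /kernel_mean -sumrB; apply: eq_bigr => x _; rewrite mulrBr. Qed.

Lemma kernel_meanZ P s a c f :
  kernel_mean P s a (fun x => c * f x) = c * kernel_mean P s a f.
Proof. by rewrite /kernel_mean mulr_sumr; apply: eq_bigr => x _; rewrite mulrCA. Qed.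

Lemma kernel_mean_cst P s a c : is_kernel P -> kernel_mean P s a (fun=> c) = c.
Proof. by move=> kP; rewrite /kernel_mean -mulr_suml kP.2 mul1r. Qed.

Lemma kernel_mean_le P s a f g : is_kernel P -> (forall x, f x <= g x) ->
  kernel_mean P s a f <= kernel_mean P s a g.
Proof. by move=> kP fg; apply: ler_sum => x _; rewrite ler_wpM2l ?kP.1. Qed.

Lemma kernel_varE P s a f : is_kernel P ->
  kernel_var P s a f = kernel_mean P s a (fun x => f x ^+ 2) - kernel_mean P s a f ^+ 2.
Proof.
move=> kP; set m := kernel_mean P s a f.
have -> : kernel_var P s a f =
    kernel_mean P s a (fun x => f x ^+ 2 - ((2 * m) * f x - m ^+ 2)).
  by apply: eq_bigr => x _; rewrite -/m; congr (_ * _); ring.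
rewrite kernel_meanB kernel_meanB kernel_meanZ kernel_mean_cst// -/m; ring.
Qed.

(** With [m] the mean of [f], the variance of [f^2] is at most its second moment about [m^2], and
    [(f^2 - m^2)^2 = (f + m)^2 (f - m)^2] with [f + m <= 2 B]. *)
Lemma kernel_var_sqr_le P s a f (B : R) : is_kernel P -> (forall x, 0 <= f x <= B) ->
  kernel_var P s a (fun x => f x ^+ 2) <= 4 * B ^+ 2 * kernel_var P s a f.
Proof.
move=> kP fB; set m := kernel_mean P s a f.
have m0 : 0 <= m.
  by rewrite -(kernel_mean_cst s a 0 kP); apply: kernel_mean_le => // x; case/andP: (fB x).
have mB : m <= B.
  by rewrite -(kernel_mean_cst s a B kP); apply: kernel_mean_le => // x; case/andP: (fB x).
apply: (@le_trans _ _ (kernel_mean P s a (fun x => (f x ^+ 2 - m ^+ 2) ^+ 2))).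
  rewrite kernel_varE//; set M := kernel_mean P s a (fun x => f x ^+ 2).
  have -> : kernel_mean P s a (fun x => (f x ^+ 2 - m ^+ 2) ^+ 2) =
      kernel_mean P s a (fun x => (f x ^+ 2) ^+ 2 - (2 * m ^+ 2 * f x ^+ 2 - m ^+ 4)).
    by apply: eq_bigr => x _; congr (_ * _); ring.
  rewrite kernel_meanB kernel_meanB kernel_meanZ kernel_mean_cst// -/M.
  have := sqr_ge0 (M - m ^+ 2); rewrite !expr2; lra.
rewrite -kernel_meanZ; apply: kernel_mean_le => // x; rewrite -/m.
have /andP[f0 f1] := fB x.
have -> : (f x ^+ 2 - m ^+ 2) ^+ 2 = (f x + m) ^+ 2 * (f x - m) ^+ 2 by ring.
rewrite ler_wpM2r ?sqr_ge0//.
have -> : 4 * B ^+ 2 = (2 * B) ^+ 2 by ring.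
by rewrite ler_pXn2r ?nnegrE//; lra.
Qed.

(** Jensen's inequality, from nonnegativity of the variance. It compares the per-action means of [h]
    with their average under the policy. *)
Lemma sqr_convex_le (w x : A -> R) : (forall a, 0 <= w a) -> \sum_a w a = 1 ->
  (\sum_a w a * x a) ^+ 2 <= \sum_a w a * x a ^+ 2.
Proof.
move=> w0 w1; have [m mE] : exists m, \sum_a w a * x a = m by eexists.
rewrite mE.
have : 0 <= \sum_a w a * (x a - m) ^+ 2.
  by apply: sumr_ge0 => a _; rewrite mulr_ge0 ?sqr_ge0.
have -> : \sum_a w a * (x a - m) ^+ 2 =
    \sum_a w a * x a ^+ 2 - (2 * m * (\sum_a w a * x a) - m ^+ 2 * \sum_a w a).
  rewrite !mulr_sumr -!sumrB; apply: eq_bigr => a _; ring.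
rewrite w1 mE !expr2; lra.
Qed.

Variables (P P' : S -> A -> S -> R) (pi r : S -> A -> R).
Hypotheses (kP : is_kernel P) (kP' : is_kernel P') (kpi : is_policy pi).
Hypothesis r01 : forall s a, 0 <= r s a <= 1.

Let dev s a f := kernel_mean P' s a f - kernel_mean P s a f.

(* The Poisson equation controls the variance of [h] under [P], averaged along the stationary law of [P'], by [B] and the deviation of [h ^ 2]. *)
Lemma gain_deviation (c : R) (h : S -> R) (B lam kap eps : R) (s : S) :
  0 <= c <= 1 -> (forall x, 0 <= h x <= B) -> 1 <= B ->
  (forall x, c + h x = rpi r pi x + markov_op (Ppi P pi) h x) ->
  0 < lam -> 3 * lam * B <= 1 -> eps = 9 * lam ^+ 2 * B -> 8 * B ^+ 2 * kap = 1 ->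
  (forall x a, lam * dev x a h <= lam ^+ 2 * kernel_var P x a h + eps) ->
  (forall x a, - lam * dev x a h <= lam ^+ 2 * kernel_var P x a h + eps) ->
  (forall x a, - kap * dev x a (fun y => h y ^+ 2) <=
     kap ^+ 2 * kernel_var P x a (fun y => h y ^+ 2) + eps) ->
  `|gain P' pi r s - c| <= 29 * lam * B.
Proof.
move=> c01 hB B1 hE lam0 lamB epsE kapE devp devn devsq.
have [mu [mu0 mu1 mus ->]] := gain_law r kP' kpi s.
(* Expectation with the state drawn from the stationary law of [P'] and the action from [pi]. *)
pose avg (F : S -> A -> R) := \sum_x mu x * \sum_a pi x a * F x a.
have avg_le al be ga F G : (forall x a, al * F x a <= be * G x a + ga) ->
    al * avg F <= be * avg G + ga.
  move=> FG; have -> : be * avg G + ga = avg (fun x a => be * G x a + ga).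
    rewrite /avg -[X in _ + X]mulr1 -mu1 !mulr_sumr -big_split; apply: eq_bigr => x _ /=.
    under [in RHS]eq_bigr do rewrite mulrDr mulrCA.
    rewrite big_split /= -mulr_sumr -mulr_suml kpi.2; ring.
  rewrite mulr_sumr; apply: ler_sum => x _.
  rewrite mulrCA ler_wpM2l// mulr_sumr; apply: ler_sum => a _.
  by rewrite mulrCA ler_wpM2l ?kpi.1.
(* Stationarity of [mu] under [P'] replaces the [P']-mean of [f] by [f] itself. *)
have avg_dev f : avg (fun x a => dev x a f) =
    \sum_x mu x * (f x - markov_op (Ppi P pi) f x).
  under [RHS]eq_bigr do rewrite mulrBr.
  rewrite sumrB -mus -sumrB; apply: eq_bigr => x _.
  rewrite -mulrBr !markov_op_PpiE -sumrB; congr (_ * _).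
  by apply: eq_bigr => a _; rewrite mulrBr.
set G := \sum_x _.
have GE : G - c = avg (fun x a => dev x a h).
  rewrite avg_dev /G -[X in _ - X]mulr1 -mu1 mulr_sumr -sumrB; apply: eq_bigr => x _.
  have := hE x => hx; rewrite (_ : rpi r pi x = c + h x - markov_op (Ppi P pi) h x); last by lra.
  ring.
pose X := avg (fun x a => kernel_var P x a h).
have B0 : 0 < B by lra.
have kap0 : 0 < kap.
  have : 0 < 8 * B ^+ 2 * kap by rewrite kapE.
  by rewrite pmulr_rgt0// mulr_gt0// exprn_gt0.
(* At each state, Jensen bounds the averaged variance by [P_pi h^2 - (P_pi h)^2]. The Poisson
   equation gives [P_pi h = h - (r_pi - c)], whose square is at least [h^2 - 2 B]. *)
have X1 : X <= 2 * B - avg (fun x a => dev x a (fun y => h y ^+ 2)).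
  rewrite avg_dev /X /avg.
  have -> : 2 * B = \sum_x mu x * (2 * B) by rewrite -mulr_suml mu1 mul1r.
  rewrite -sumrB; apply: ler_sum => x _; rewrite -mulrBr ler_wpM2l//.
  under eq_bigr do rewrite kernel_varE// mulrBr.
  rewrite sumrB -markov_op_PpiE.
  have := sqr_convex_le (fun a => kernel_mean P x a h) (kpi.1 x) (kpi.2 x).
  rewrite -markov_op_PpiE; set Ph := markov_op _ h x => Jn.
  have /andP[h0 h1] := hB x.
  have /andP[r0 r1] := rpi_ge0_le1 kpi r01 x.
  have PhE : Ph = h x - (rpi r pi x - c) by have := hE x; rewrite -/Ph; lra.
  have : h x * (rpi r pi x - c) <= B by nra.
  have : Ph ^+ 2 >= h x ^+ 2 - 2 * (h x * (rpi r pi x - c)).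
    by rewrite PhE; have := sqr_ge0 (rpi r pi x - c); lra.
  lra.
have X2 : - kap * avg (fun x a => dev x a (fun y => h y ^+ 2)) <=
    kap ^+ 2 * (4 * B ^+ 2) * X + eps.
  apply: avg_le => x a; apply: (le_trans (devsq x a)).
  rewrite lerD2r -[leRHS]mulrA ler_wpM2l ?sqr_ge0//; exact: kernel_var_sqr_le.
have lB2 : (3 * lam * B) ^+ 2 <= 1 by rewrite expr_le1// !mulr_ge0//; lra.
(* Multiplying [X2] by [8 B^2 = 1 / kap] leaves [X / 2] on the right, plus [8 B (3 lam B)^2 <= 8 B].
   With [X1], [X <= 2 B + X / 2 + 8 B]. *)
have X3 : X <= 20 * B.
  move: X1 X2; set D := avg _ => X1 X2.
  have : 8 * B ^+ 2 * (- kap * D) <= 8 * B ^+ 2 * (kap ^+ 2 * (4 * B ^+ 2) * X + eps).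
    by rewrite ler_wpM2l// mulr_ge0 ?sqr_ge0.
  have -> : 8 * B ^+ 2 * (- kap * D) = - D * (8 * B ^+ 2 * kap) by ring.
  have -> : 8 * B ^+ 2 * (kap ^+ 2 * (4 * B ^+ 2) * X + eps) =
    (8 * B ^+ 2 * kap) ^+ 2 * X / 2 + 8 * B * (3 * lam * B) ^+ 2.
    by rewrite epsE; field.
  rewrite kapE expr1n mul1r mulr1.
  have : 8 * B * (3 * lam * B) ^+ 2 <= 8 * B by rewrite ger_pMr// mulr_gt0.
  lra.
(* The constant is [29 = 20 + 9], from [X3] and [eps]. *)
have fin D : lam * D <= lam ^+ 2 * X + eps -> D <= 29 * lam * B.
  move=> DX; rewrite -(ler_pM2l lam0); apply: (le_trans DX).
  have : lam ^+ 2 * X <= lam ^+ 2 * (20 * B) by rewrite ler_wpM2l ?sqr_ge0.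
  rewrite epsE !expr2; lra.
rewrite GE ler_norml; apply/andP; split.
  rewrite lerNl; apply: fin; rewrite mulrN -mulNr; exact: avg_le.
by apply: fin; exact: avg_le.
Qed.

End GainDeviation.

(** * Span, the one-state case and numerical constants *)

Lemma spnorm_ge (R : realType) (S : finType) (x : S -> R) s s' : x s - x s' <= spnorm x.
Proof.
rewrite /spnorm; apply: le_trans (le_bigmax _ _ s).
exact: (le_bigmax _ (fun s' => x s - x s')).
Qed.

(** Settles the case of at most one state, where the logarithm in the claim may be arbitrarily close
    to 0. *)
Lemma Phat_subsingleton (R : realType) (S A : finType) (P : S -> A -> S -> R) n
  (w : sample_space S A n) : is_kernel P -> (0 < n)%N -> (#|S| <= 1)%N -> @Phat R S A n w = P.
Proof.
move=> kP n0 S1.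
have one (P' : S -> A -> S -> R) : is_kernel P' -> forall s a s', P' s a s' = 1.
  move=> kP' s a s'; rewrite -(kP'.2 s a) (bigD1 s')//= big1 ?addr0// => x.
  by move/card_le1P : S1 => /(_ s' isT x); rewrite !inE => <-.
apply/funext => s; apply/funext => a; apply/funext => s'.
by rewrite !one//; exact: Phat_kernel.
Qed.

(** [3 N] counts the tests of the union bound, three per pair. With [x = N n / delta >= 2],
    [3 N / delta <= 3 x <= x^3]; then [ln x >= ln 2 >= 1 / 2] gives [3 ln x <= 12 (ln x)^3]. *)
Lemma ln_count_le (R : realType) (N n : nat) (delta : R) : (2 <= N)%N -> (0 < n)%N ->
  0 < delta < 1 ->
  0 < ln ((3 * N)%:R / delta) /\
  ln ((3 * N)%:R / delta) <= 12 * ln ((N * n)%:R / delta) ^+ 3.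
Proof.
move=> N2 n0 /andP[d0 d1].
have N2' : 2 <= N%:R :> R by rewrite ler_nat.
have dN : N%:R <= N%:R / delta by rewrite ler_pdivlMr// ger_pMr; lra.
have nN : N%:R / delta <= (N * n)%:R / delta.
  by rewrite ler_pM2r ?invr_gt0// ler_nat leq_pmulr.
set x := (N * n)%:R / delta in nN *.
have x2 : 2 <= x by lra.
split.
  apply: ln_gt0; apply: (@lt_le_trans _ _ (3 * (N%:R / delta))); first by lra.
  by rewrite natrM mulrA.
have half : 1 / 2 <= ln x.
  have := @le_ln1Dx R (- (1 / 2)); have -> : 1 + - (1 / 2) = (2 : R)^-1 by field.
  rewrite lnV ?posrE// => h; have l2 : ln 2 <= ln x :> R by rewrite ler_ln ?posrE; lra.
  have : - ln 2 <= - (1 / 2) :> R by apply: h; lra.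
  lra.
apply: (@le_trans _ _ (3 * ln x)).
  have -> : 3 * ln x = ln (x ^+ 3) by rewrite lnXn ?mulr_natl//; lra.
  rewrite ler_ln ?posrE//; last 2 first.
  - by rewrite divr_gt0// ltr0n muln_gt0/=; lia.
  - by rewrite exprn_gt0; lra.
  rewrite natrM -mulrA; apply: (@le_trans _ _ (3 * x)); first by rewrite ler_pM2l.
  rewrite exprS mulrC ler_pM2l; last by lra.
  rewrite expr2; nra.
rewrite exprS; have : 1 / 4 <= ln x ^+ 2 by rewrite expr2; nra.
move=> h; have : ln x * (1 / 4) <= ln x * ln x ^+ 2 by rewrite ler_pM2l; lra.
lra.
Qed.

(** [lam] makes [3 lam B = sqrt (L B / n)]. Hence [(29 lam B)^2 = (841 / 9) L B / n <= 100 L B / n],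
    and [L <= 12 l] yields [1200 = 100 * 12]. If [3 lam B > 1], then [L B > n] and the radius is at
    least 1. *)
Lemma deviation_radius (R : realType) (n : nat) (L l B : R) : (0 < n)%N -> 0 < L ->
  L <= 12 * l -> 1 <= B ->
  let lam := Num.sqrt (L / (n%:R * B)) / 3 in
  [/\ 0 < lam, L / n%:R = 9 * lam ^+ 2 * B,
      29 * lam * B <= Num.sqrt (1200 * l / n%:R * B) &
      1 < 3 * lam * B -> 1 <= Num.sqrt (1200 * l / n%:R * B)].
Proof.
move=> n0 L0 Ll B1 lam.
have n0' : 0 < n%:R :> R by rewrite ltr0n.
have B0 : 0 < B by lra.
have q0 : 0 < L / (n%:R * B) by rewrite divr_gt0// mulr_gt0.
have lam0 : 0 < lam by rewrite divr_gt0// sqrtr_gt0.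
have eps : L / n%:R = 9 * lam ^+ 2 * B.
  rewrite /lam expr_div_n sqr_sqrtr ?ltW//.
  have Bn : B != 0 by rewrite gt_eqF.
  have nn : n%:R != 0 :> R by rewrite gt_eqF.
  by field; rewrite Bn nn.
clearbody lam.
have ge_sqr y : 0 <= y -> y ^+ 2 <= 100 * (L / n%:R) * B ->
    y <= Num.sqrt (1200 * l / n%:R * B).
  move=> y0 yL; rewrite -(ger0_norm y0) -sqrtr_sqr ler_sqrt.
    apply: (le_trans yL); rewrite ler_pM2r// mulrA ler_pM2r ?invr_gt0//; lra.
  apply: mulr_ge0; last exact: ltW.
  by apply: divr_ge0; [lra | exact: ltW].
have p2 : 0 <= lam ^+ 2 * B ^+ 2 by rewrite mulr_ge0 ?sqr_ge0.
split => //.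
- apply: ge_sqr; first by rewrite !mulr_ge0 // ltW.
  rewrite eps; have -> : (29 * lam * B) ^+ 2 = 841 * (lam ^+ 2 * B ^+ 2) by ring.
  have -> : 100 * (9 * lam ^+ 2 * B) * B = 900 * (lam ^+ 2 * B ^+ 2) by ring.
  lra.
- move=> big; apply: ge_sqr => //; rewrite expr1n eps.
  have : 1 < (3 * lam * B) ^+ 2 by rewrite expr_gt1//; lra.
  have -> : (3 * lam * B) ^+ 2 = 9 * (lam ^+ 2 * B ^+ 2) by ring.
  have -> : 100 * (9 * lam ^+ 2 * B) * B = 900 * (lam ^+ 2 * B ^+ 2) by ring.
  lra.
Qed.

(** * The deviation event for [h] and its square *)

Section Concentration.
Variables (R : realType) (S A : finType) (P : S -> A -> S -> R) (n : nat).
Hypotheses (kP : is_kernel P) (n0 : (0 < n)%N).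
Variables (h : S -> R) (B lam kap L : R).

Definition centered (k : R) (f : S -> R) (p : S * A) (x : S) : R :=
  k * (f x - kernel_mean P p.1 p.2 f).

Lemma centered_mean k f p : \sum_x P p.1 p.2 x * centered k f p x = 0.
Proof.
rewrite -[LHS]/(kernel_mean P p.1 p.2 (centered k f p)) /centered.
by rewrite kernel_meanZ kernel_meanB kernel_mean_cst// subrr mulr0.
Qed.

Lemma centered_bound (w : sample_space S A n) k f s a :
  \sum_(j < n) centered k f (s, a) (w (s, a, j)) <=
    n%:R * (\sum_x P s a x * centered k f (s, a) x ^+ 2) + L ->
  k * (kernel_mean (@Phat R S A n w) s a f - kernel_mean P s a f) <=
    k ^+ 2 * kernel_var P s a f + L / n%:R.
Proof.
have n0' : 0 < n%:R :> R by rewrite ltr0n.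
have -> : \sum_x P s a x * centered k f (s, a) x ^+ 2 = k ^+ 2 * kernel_var P s a f.
  by rewrite /kernel_var mulr_sumr; apply: eq_bigr => x _; rewrite /centered exprMn mulrCA.
have -> : \sum_(j < n) centered k f (s, a) (w (s, a, j)) =
    n%:R * (k * (kernel_mean (@Phat R S A n w) s a f - kernel_mean P s a f)).
  rewrite {1}/kernel_mean Phat_sum -mulr_sumr sumrB sumr_const card_ord.
  rewrite -[_ *+ n]mulr_natl [RHS]mulrCA; congr (_ * _).
  by rewrite mulrBr; congr (_ - _); rewrite mulrC divfK// gt_eqF.
by move=> H; rewrite -(ler_pM2l n0') [leRHS]mulrDr [X in _ <= _ + X]mulrC divfK ?gt_eqF.
Qed.

(** Each pair gets three tests: [h] with both signs, and [h^2] with the sign that the variance bound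
    uses. *)
Lemma deviation_event_prob :
  (forall x, 0 <= h x <= B) -> 1 <= B -> 0 < lam -> 3 * lam * B <= 1 ->
  8 * B ^+ 2 * kap = 1 ->
  1 - (3 * (#|S| * #|A|))%:R * expR (- L) <=
  prob P [pred w : sample_space S A n | `[< forall s a,
    let dev f := kernel_mean (@Phat R S A n w) s a f - kernel_mean P s a f in
    [/\ lam * dev h <= lam ^+ 2 * kernel_var P s a h + L / n%:R,
        - lam * dev h <= lam ^+ 2 * kernel_var P s a h + L / n%:R &
        - kap * dev (fun y => h y ^+ 2) <=
          kap ^+ 2 * kernel_var P s a (fun y => h y ^+ 2) + L / n%:R] >]].
Proof.
move=> hB B1 lam0 lamB kapE.
pose g (i : option bool * (S * A)) : S -> R := match i.1 with
  | Some true => centered lam h i.2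
  | Some false => centered (- lam) h i.2
  | None => centered (- kap) (fun y => h y ^+ 2) i.2 end.
have mB f K s a : (forall x, 0 <= f x <= K) -> 0 <= kernel_mean P s a f <= K.
  move=> fK; apply/andP; split; [rewrite -(kernel_mean_cst s a 0 kP) |
    rewrite -[leRHS](kernel_mean_cst s a K kP)]; by apply: kernel_mean_le => // x; case/andP: (fK x).
(* [f] and its mean both lie in [[0, K]]. The condition holds for [h] by [3 lam B <= 1], and for
   [h^2] because [kap B^2 = 1 / 8]. *)
have cb f K k p x : (forall x, 0 <= f x <= K) -> `|k| * K <= 1 / 3 ->
    centered k f p x <= 1 / 3.
  move=> fK kK; apply: (le_trans _ kK); apply: (le_trans (ler_norm _)).
  rewrite normrM ler_wpM2l//; have := mB f K p.1 p.2 fK; have := fK x.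
  by rewrite ler_norml => /andP[? ?] /andP[? ?]; apply/andP; split; lra.
have kap0 : 0 < kap.
  have : 0 < 8 * B ^+ 2 * kap by rewrite kapE.
  by rewrite pmulr_rgt0// mulr_gt0// exprn_gt0; lra.
have h2B x : 0 <= h x ^+ 2 <= B ^+ 2.
  have /andP[? ?] := hB x; rewrite sqr_ge0/=.
  by rewrite ler_pXn2r ?nnegrE//; lra.
have g3 i x : g i x <= 1 / 3.
  case: i => -[[]|] p; rewrite /g /=.
  - by apply: (cb _ B) => //; rewrite gtr0_norm//; lra.
  - by apply: (cb _ B) => //; rewrite normrN gtr0_norm//; lra.
  - by apply: (cb _ (B ^+ 2)) => //; rewrite normrN gtr0_norm//; lra.
have g0 i : \sum_x P i.2.1 i.2.2 x * g i x = 0.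
  by case: i => -[[]|] p; exact: centered_mean.
have := bernstein_uniform n kP L g3 g0.
rewrite card_prod card_option card_bool card_prod => /le_trans; apply.
apply: prob_le => // w /forallP Hw; apply/asboolP => s a; split.
- exact: centered_bound (Hw (Some true, (s, a))).
- have := centered_bound (Hw (Some false, (s, a))).
  by rewrite sqrrN.
- have := centered_bound (Hw (None, (s, a))).
  by rewrite sqrrN.
Qed.

End Concentration.

(** * Choice of parameters and conclusion *)

Theorem mainTheorem2 (R : realType) :
  exists C : R, 0 < C /\
  forall (S A : finType) (P : S -> A -> S -> R) (r : S -> A -> R)
         (pi : S -> A -> R) (n : nat) (delta : R),
    is_kernel P ->
    (forall s a, 0 <= r s a <= 1) ->
    is_policy pi ->
    (exists c : R, forall s, gain P pi r s = c) ->
    (0 < n)%N ->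
    0 < delta < 1 ->
    1 - delta <=
      prob P [pred w : sample_space S A n |
        supnorm (fun s => gain (@Phat R S A n w) pi r s - gain P pi r s) <=
        Num.sqrt (C * (ln ((#|S| * #|A| * n)%:R / delta)) ^+ 3 / n%:R
                  * (spnorm (bias P pi r) + 1))].
Proof.
exists 1200; split=> [|S A P r pi n delta kP r01 kpi [c gainE] n0 d01]; first by rewrite ltr0n.
have /andP[d0 d1] := d01.
have n0' : 0 < n%:R :> R by rewrite ltr0n.
have [S1|S2] := leqP #|S| 1.
  rewrite (probT kP); first by lra.
  move=> w; rewrite inE (Phat_subsingleton w kP n0 S1) /supnorm.
  apply: bigmax_le => [|s _]; first exact: sqrtr_ge0.
  by rewrite subrr normr0 sqrtr_ge0.
have /card_gt0P[s0 _] : (0 < #|S|)%N by rewrite (leq_trans _ S2).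
have A1 : (0 < #|A|)%N.
  rewrite lt0n; apply/negP => /eqP A0; have := kpi.2 s0.
  rewrite big1 => [/esym/eqP|a _]; first by rewrite oner_eq0.
  by have := card0_eq A0 a; rewrite inE.
have N2 : (2 <= #|S| * #|A|)%N by rewrite (leq_trans S2)// leq_pmulr.
have [L0 Ll] := ln_count_le N2 n0 d01.
set L := ln ((3 * _)%:R / _) in L0 Ll.
set l := ln _ ^+ 3; rewrite -/l in Ll.
pose b := bias P pi r.
(* Subtracting the minimum of the bias puts [h] in [[0, B]]; the Poisson equation survives because
   [P_pi] fixes constants. *)
have [s1 _ s1P] := @arg_minP _ _ _ s0 predT b isT.
pose h s := b s - b s1.
set B := spnorm _ + 1.
have hB x : 0 <= h x <= B.
  rewrite subr_ge0 s1P//= /B; have := spnorm_ge b x s1; rewrite /h -/b; lra.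
have B1 : 1 <= B by rewrite lerDr; have := spnorm_ge b s0 s0; rewrite subrr.
have c01 : 0 <= c <= 1 by rewrite -(gainE s0); exact: gain_ge0_le1.
have [lam0 epsE main big] := deviation_radius n0 L0 Ll B1.
set lam := Num.sqrt (L / (n%:R * B)) / 3 in lam0 epsE main big.
(* Otherwise the radius is at least 1, which bounds any difference of gains. *)
have [lamB|{}/big big] := leP (3 * lam * B) 1; last first.
  rewrite (probT kP); first by lra.
  move=> w; rewrite inE; apply: (le_trans _ big).
  apply: bigmax_le => // s _; rewrite gainE.
  have := gain_ge0_le1 (Phat_kernel R w n0) kpi r01 s.
  by move: c01 => /andP[? ?] /andP[? ?]; rewrite ler_norml; apply/andP; split; lra.
pose kap := (8 * B ^+ 2)^-1.
have kapE : 8 * B ^+ 2 * kap = 1.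
  by rewrite divff// mulf_neq0// expf_neq0// gt_eqF//; lra.
have hE x : c + h x = rpi r pi x + markov_op (Ppi P pi) h x.
  have -> : markov_op (Ppi P pi) h x = markov_op (Ppi P pi) b x - b s1.
    rewrite (markov_opB _ b (fun=> b s1)) [X in _ - X]/markov_op -mulr_suml.
    by rewrite Ppi_sum1// mul1r.
  by rewrite -(gainE x); have := poisson_equation r kP kpi x; rewrite /h /b; lra.
(* [L] was chosen so that the union bound over the [3 S A] tests costs exactly [delta]. *)
have -> : delta = (3 * (#|S| * #|A|))%:R * expR (- L).
  have N0 : 0 < (3 * (#|S| * #|A|))%:R :> R by rewrite ltr0n muln_gt0 (leq_trans _ N2).
  rewrite expRN lnK; last by rewrite posrE divr_gt0.
  by rewrite invf_div mulrC divfK// gt_eqF.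
apply: (le_trans (deviation_event_prob kP n0 L hB B1 lam0 lamB kapE)).
apply: prob_le => // w /asboolP Hw; rewrite inE.
apply: bigmax_le => [|s _]; first exact: sqrtr_ge0.
rewrite gainE; apply: (le_trans _ main).
apply: (gain_deviation kP (Phat_kernel R w n0) kpi r01 s c01 hB B1 hE lam0 lamB epsE kapE).
- by move=> x a; have [] := Hw x a.
- by move=> x a; have [] := Hw x a.
- by move=> x a; have [] := Hw x a.
Qed.
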